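(* Let $\mathbb{F}_q$ be a finite field. The eigenvalues of the Radon transform $\mathcal{R}$ of type $\lambda=(2,1)$ in the Yokonuma-Hecke algebra $\mathcal{H}(GL_3(\mathbb{F}_q),U_{(1,1,1)})$ form a subset of $\{1,q,q^2,q^3,q^4\}$.
   Context: For a tuple $\mu$ of positive integers with sum $3$, $U_\mu\subset GL_3(\mathbb{F}_q)$ is the group of block upper triangular matrices whose diagonal blocks are identity matrices of sizes given by $\mu$, and $U_\mu^{op}$ is the group of transposes. Thus $U_{(1,1,1)}$ is the group of upper triangular matrices with $1$'s on the diagonal. For a subgroup $H$ of a finite group $G$, $e_H=\frac{1}{|H|}\sum_{h\in H}h\in\mathbb{C}[G]$. The Radon element of type $\lambda=(2,1)$ is $\mathcal{R}=|U_{(2,1)}|^2e_{U_{(2,1)}}e_{U_{(2,1)}^{op}}e_{U_{(2,1)}}\in\mathbb{C}[GL_3(\mathbb{F}_q)]$. The Yokonuma-Hecke algebra is $\mathcal{H}(GL_3(\mathbb{F}_q),U_{(1,1,1)})=e\,\mathbb{C}[GL_3(\mathbb{F}_q)]\,e$ with unit $e=e_{U_{(1,1,1)}}$. The element $\mathcal{R}$ commutes with $e$, and ''the Radon transform in the Yokonuma-Hecke algebra'' is the element $e\mathcal{R}e=\mathcal{R}e$ of this algebra; its eigenvalues are those of the linear operator $x\mapsto x\mathcal{R}$ on $e\,\mathbb{C}[GL_3(\mathbb{F}_q)]\,e$. *)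

(* Defs.v *)
From mathcomp Require Import all_boot all_order all_algebra all_fingroup.
From mathcomp Require Import mxrepresentation ring.

Set Implicit Arguments.
Unset Strict Implicit.
Unset Printing Implicit Defensive.

Import GRing.Theory Num.Theory.
Local Open Scope ring_scope.

(* A group algebra element \sum_g c_g g is represented by its matrix
   \sum_g c_g *: regular_repr K G g in the (faithful) regular representation,
   as in mxrepresentation; the product of K[G] is then *m. *)
Section GroupAlgebra.
Variables (K : numFieldType) (gT : finGroupType) (G : {group gT}).

Definition group_alg : {vspace 'M[K]_#|G|} :=
  <<[seq regular_repr K G g | g in G]>>%VS.

Definition subgroup_idem (H : {set gT}) : 'M[K]_#|G| :=
  (#|H|%:R)^-1 *: gset_mx K G H.

(* e K[G] e for e = subgroup_idem H *)
Definition hecke_alg (H : {set gT}) : {vspace 'M[K]_#|G|} :=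
  let e := subgroup_idem H in
  (linfun (mulmxr e \o mulmx e) @: group_alg)%VS.

Lemma group_algE x : (x \in group_alg) = (x \in group_ring K G)%MS.
Proof.
apply/idP/idP => [|/envelop_mxP[c ->]]; last first.
  by apply: memv_suml => g Gg; apply/memvZ/memv_span/image_f.
move/coord_span ->; rewrite linear_sum summx_sub // => i _.
rewrite linearZ scalemx_sub //=.
have ltis : (i < size [seq regular_repr K G g | g in G])%N by rewrite size_image.
have /imageP[g Gg ->] := mem_nth 0 ltis.
exact: envelop_mx_id.
Qed.

Lemma group_algM x y : x \in group_alg -> y \in group_alg -> x *m y \in group_alg.
Proof. by rewrite !group_algE; apply: envelop_mxM. Qed.

Lemma subgroup_idem_alg (H : {set gT}) :
  H \subset G -> subgroup_idem H \in group_alg.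
Proof.
move=> /subsetP sHG; apply/memvZ/memv_suml => h Hh.
exact/memv_span/image_f/sHG.
Qed.

Lemma hecke_algP (H : {set gT}) x :
  reflect (exists2 y, y \in group_alg
             & x = subgroup_idem H *m y *m subgroup_idem H)
          (x \in hecke_alg H).
Proof.
by apply: (iffP memv_imgP) => -[y Gy ->]; exists y; rewrite // lfunE.
Qed.

Section Translation.
Variable H : {group gT}.
Hypothesis sHG : H \subset G.
Local Notation e := (subgroup_idem H).

Lemma subgroup_idemMr h : h \in H -> e *m regular_repr K G h = e.
Proof.
move=> Hh; rewrite -scalemxAl mulmx_suml; congr (_ *: _).
rewrite (reindex_inj (mulIg h^-1%g)) /=; apply: eq_big => g /=.
  by rewrite groupMr ?groupV.
by move=> Hg; rewrite -repr_mxM ?(subsetP sHG) // mulgKV.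
Qed.

Lemma subgroup_idem_fixr (x : 'M[K]_#|G|) :
  {in H, forall h, x *m regular_repr K G h = x} -> x *m e = x.
Proof.
move=> xH; rewrite -scalemxAr mulmx_sumr (eq_bigr (fun=> x)) //.
rewrite sumr_const -scaler_nat scalerA mulVf ?scale1r //.
by rewrite pnatr_eq0 -lt0n cardG_gt0.
Qed.

End Translation.

Lemma subgroup_idemJ (H : {set gT}) g :
    H \subset G -> g \in G -> (H :^ g = H)%g ->
  regular_repr K G g *m subgroup_idem H = subgroup_idem H *m regular_repr K G g.
Proof.
move=> sHG Gg nHg; rewrite -scalemxAl -scalemxAr; congr (_ *: _).
rewrite mulmx_suml mulmx_sumr [LHS](reindex_inj (conjg_inj g)) /=.
apply: eq_big => h; first by rewrite -{1}nHg memJ_conjg.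
move=> /(subsetP sHG); rewrite groupJr // => Gh.
by rewrite -!repr_mxM ?groupJ // -conjgC.
Qed.

End GroupAlgebra.

Section BlockUnipotent.
Variables (F : finFieldType) (n : nat).

(* reshape_index mu i is the index of the block of mu that contains i. *)
Definition block_unitriangular (mu : seq nat) (A : 'M[F]_n.-1.+1) : bool :=
  [forall i : 'I_n.-1.+1, forall j : 'I_n.-1.+1,
     (reshape_index mu j <= reshape_index mu i)%N ==> (A i j == (i == j)%:R)].

Definition U_mu (mu : seq nat) : {set {'GL_n[F]}} :=
  [set u | block_unitriangular mu (GLval u)].

Definition Uop_mu (mu : seq nat) : {set {'GL_n[F]}} :=
  [set u | block_unitriangular mu (GLval u)^T].

End BlockUnipotent.

Section Radon.
Variables (K : numFieldType) (F : finFieldType).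

Local Notation G := 'GL_3[F]%G.
Local Notation idem := (subgroup_idem K G).

Definition radon : 'M[K]_#|G| :=
  let U := U_mu F 3 [:: 2; 1]%N in
  let V := Uop_mu F 3 [:: 2; 1]%N in
  #|U|%:R ^+ 2 *: (idem U *m idem V *m idem U).

Definition yokonuma_hecke : {vspace 'M[K]_#|G|} :=
  hecke_alg K G (U_mu F 3 [:: 1; 1; 1]%N).

(* x |-> x R; yokonuma_hecke is stable under it, so that vsproj only changes the
   type: see radon_opE. *)
Definition radon_op : 'End(subvs_of yokonuma_hecke) :=
  linfun (vsproj yokonuma_hecke \o mulmxr radon \o vsval).

Local Notation B := (U_mu F 3 [:: 1; 1; 1]%N).
Local Notation U := (U_mu F 3 [:: 2; 1]%N).
Local Notation V := (Uop_mu F 3 [:: 2; 1]%N).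

Lemma sum3 (R : nmodType) (f : 'I_3 -> R) :
  \sum_k f k = f 0 + f 1 + f 2%:R.
Proof.
rewrite !big_ord_recl big_ord0 addr0 addrA.
by congr (f _ + f _ + f _); apply: val_inj.
Qed.

Lemma ord3P (P : 'I_3 -> Prop) : P 0 -> P 1 -> P 2%:R -> forall i, P i.
Proof.
move=> P0 P1 P2 [[|[|[|//]]] lti3].
- by rewrite (_ : Ordinal _ = 0) //; apply: val_inj.
- by rewrite (_ : Ordinal _ = 1) //; apply: val_inj.
- by rewrite (_ : Ordinal _ = 2%:R) //; apply: val_inj.
Qed.

Lemma block111P (A : 'M[F]_3) : reflect
  [/\ A 0 0 = 1, A 1 1 = 1, A 2%:R 2%:R = 1 &
   [/\ A 1 0 = 0, A 2%:R 0 = 0 & A 2%:R 1 = 0]]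
  (@block_unitriangular F 3 [:: 1; 1; 1]%N A).
Proof.
apply: (iffP 'forall_forallP) => [bA | [A00 A11 A22 [A10 A20 A21]]].
  by split; last split; apply/eqP; apply: (implyP (bA _ _)).
by do 2![apply: ord3P]; apply/implyP => // _; apply/eqP.
Qed.

Lemma block21P (A : 'M[F]_3) : reflect
  [/\ A 0 0 = 1, A 1 1 = 1, A 2%:R 2%:R = 1 &
   [/\ A 1 0 = 0, A 2%:R 0 = 0, A 2%:R 1 = 0 & A 0 1 = 0]]
  (@block_unitriangular F 3 [:: 2; 1]%N A).
Proof.
apply: (iffP 'forall_forallP) => [bA | [A00 A11 A22 [A10 A20 A21 A01]]].
  by split; last split; apply/eqP; apply: (implyP (bA _ _)).
by do 2![apply: ord3P]; apply/implyP => // _; apply/eqP.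
Qed.


Lemma B_group_set : group_set B.
Proof.
apply/group_setP; split=> [|u v]; rewrite !inE.
  by apply/block111P; rewrite GL_1E !mxE.
move=> /block111P[u00 u11 u22 [u10 u20 u21]] /block111P[v00 v11 v22 [v10 v20 v21]].
apply/block111P; rewrite GL_MxE !mxE !sum3.
by rewrite u00 u11 u22 u10 u20 u21 v00 v11 v22 v10 v20 v21; split; last split; ring.
Qed.
Definition B_group := Group B_group_set.

Definition transv (x : F) : 'M[F]_3 :=
  \matrix_(i, j) (if (i == 0) && (j == 1) then x else (i == j)%:R).

Lemma transvN x : transv (- x) *m transv x = 1%:M.
Proof.
by apply/matrixP; do 2![apply: ord3P]; rewrite !mxE sum3 !mxE /=; ring.
Qed.

Lemma transvP x : exists2 m : {'GL_3[F]},
  GLval m = transv x & GLval m^-1 = transv (- x).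
Proof.
have [_ uT] := mulmx1_unit (transvN x).
exists (Sub (transv x) uT); first exact: SubK.
by rewrite GL_VxE SubK; apply: (can_inj (mulmxK uT)); rewrite mulVmx // transvN.
Qed.

Lemma B_factor b : b \in B -> exists m,
  [/\ m \in B, (b * m^-1)%g \in U, (U :^ m = U)%g & (V :^ m = V)%g].
Proof.
rewrite inE => /block111P[b00 b11 b22 [b10 b20 b21]].
have [m mE mVE] := transvP (GLval b 0 1).
have nP (H : {set {'GL_3[F]}}) :
  {in H, forall h, h ^ m \in H}%g -> (H :^ m = H)%g.
  move=> mH; apply/eqP; rewrite eqEcard cardJg leqnn andbT.
  by apply/subsetP=> _ /imsetP[h Hh ->]; apply: mH.
exists m; split.
- by rewrite inE mE; apply/block111P; rewrite !mxE.
- rewrite inE GL_MxE mVE; apply/block21P; rewrite !mxE !sum3 !mxE /=.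
  by rewrite b00 b11 b22 b10 b20 b21; split; last split; ring.
- apply: nP => u; rewrite !inE => /block21P[u00 u11 u22 [u10 u20 u21 u01]].
  rewrite conjgE !GL_MxE mVE mE; apply/block21P; do 3!rewrite ?mxE ?sum3 /=.
  by rewrite u00 u11 u22 u10 u20 u21 u01; split; last split; ring.
apply: nP => u; rewrite !inE => /block21P; rewrite !mxE.
move=> [u00 u11 u22 [u10 u20 u21 u01]].
rewrite conjgE !GL_MxE mVE mE; apply/block21P; do 3!rewrite ?mxE ?sum3 /=.
by rewrite u00 u11 u22 u10 u20 u21 u01; split; last split; ring.
Qed.


Lemma U_group_set : group_set U.
Proof.
apply/group_setP; split=> [|u v]; rewrite !inE.
  by apply/block21P; rewrite GL_1E !mxE.
move=> /block21P[u00 u11 u22 [u10 u20 u21 u01]] /block21P[v00 v11 v22 [v10 v20 v21 v01]].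
apply/block21P; rewrite GL_MxE !mxE !sum3 u00 u11 u22 u10 u20 u21 u01.
by rewrite v00 v11 v22 v10 v20 v21 v01; split; last split; ring.
Qed.
Definition U_group := Group U_group_set.

Local Notation e := (idem B).

Lemma U_subB : U \subset B.
Proof.
by apply/subsetP=> u; rewrite !inE => /block21P[? ? ? [? ? ? _]]; apply/block111P.
Qed.

Lemma subGL (H : {set {'GL_3[F]}}) : H \subset G.
Proof. by apply/subsetP=> g _; rewrite inE. Qed.

Lemma idemB_radon : e *m radon = e *m radon *m e.
Proof.
have GL g : g \in G by rewrite inE.
have eU : e *m idem U = e.
  apply: (subgroup_idem_fixr (H := U_group)) => u Uu.
  by rewrite (subgroup_idemMr K (H := B_group) (subGL _)) // (subsetP U_subB).
symmetry; apply: (subgroup_idem_fixr (H := B_group)).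
move=> b /B_factor[m [Bm Uu nUm nVm]].
rewrite -scalemxAr -scalemxAl !mulmxA eU -[b](mulgKV m); congr (_ *: _).
rewrite repr_mxM // mulmxA -(mulmxA _ (idem U)).
rewrite (subgroup_idemMr K (H := U_group) (subGL _)) //.
rewrite -mulmxA -subgroup_idemJ ?subGL // mulmxA.
rewrite -(mulmxA e) -subgroup_idemJ ?subGL // !mulmxA.
by rewrite (subgroup_idemMr K (H := B_group) (subGL _)).
Qed.

Lemma radon_opE x : vsval (radon_op x) = vsval x *m radon.
Proof.
rewrite lfunE /= vsprojK //; have /hecke_algP[y Gy ->] := subvsP x.
apply/hecke_algP; exists (y *m e *m radon); last first.
  by rewrite -!mulmxA idemB_radon !mulmxA.
have idem_alg (H : {set {'GL_3[F]}}) : idem H \in group_alg K G.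
  by apply: subgroup_idem_alg; apply: subGL.
by rewrite !group_algM // memvZ // !group_algM.
Qed.

End Radon.

(* Main.v *)
Require Import Defs.
From mathcomp Require Import all_boot all_order all_algebra all_fingroup.
From mathcomp Require Import mxrepresentation ring.
From mathcomp Require Import reals complex.

(** Let N be the upper unitriangular group. An element x of the Hecke algebra is
fixed by right multiplication by N, so it suffices to find the eigenvalues of
the Radon element on the N-fixed vectors of an arbitrary representation of
GL_3 (here, of the regular one).

Write X_ij for the sum of the root subgroup x_ij(s) = 1 + s E_ij, and let
T_ij = X_ji s_ij, with s_ij the transposition matrix: on N-fixed vectors T_01
and T_12 are the standard generators of the Yokonuma-Hecke algebra. With
U = X_02 X_12 and V = X_21 X_20 the sums of the two abelian groups, the Radon
element is q^-2 U V U, which acts on U-fixed vectors as V U, and moving the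
reflections across gives
  V U = T_12 T_01^2 T_12     ([murphyE], [unip_fixed_radon]),
a Jucys-Murphy element. Put L = T_01^2; three facts confine its spectrum.

- A computation in the rank-one group gives the quadratic relation
  T_ij^2 = q + E_ij T_ij on x_ij-fixed vectors, where E_ij is a sum over the
  torus elements diag(-1/s, s) that commutes with T_ij and satisfies
  E_ij^3 = (q-1)^2 E_ij ([fixed_hecke_gen_quadratic], [coroot_sum3]). Hence
  (L - q)(L - 1)(L - q^2) = 0 on N-fixed vectors ([hecke_gen_sqr_roots]).
- V U commutes with L and with E_12, because the Levi subgroup GL_2 x GL_1
  normalises both abelian groups ([murphy_gen1], [murphy_coroot_sum]).
- T_12 preserves N-fixed vectors, so the cubic equation applies to w T_12 too.

So an eigenvalue a of V U has an N-fixed eigenvector w with w L = l w and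
w E_12 = c w. For u = w T_12 the quadratic relation turns w T_12 L T_12 = a w
into q u L = a (u - c w). Thus L is triangular on the span of w and u, with
diagonal entries l and a/q: either a/q is an eigenvalue of L, so that a is
q, q^2 or q^3, or u = k w with k^2 = q + c k, so that a = k^2 l with both
factors in {1, q, q^2} ([murphy_spectrum]). *)

Set Implicit Arguments.
Unset Strict Implicit.
Unset Printing Implicit Defensive.

Import GRing.Theory Num.Theory.
Local Open Scope ring_scope.
Local Open Scope complex_scope.

(** * Eigenvectors from split annihilating polynomials *)

Section Eigenvectors.
Variables (K : fieldType) (m n : nat).
Implicit Types (v w : 'M[K]_(m, n)) (A : 'M[K]_n).

Definition shift_prod A (ks : seq K) v := foldl (fun w k => w *m A - k *: w) v ks.

(** Repeatedly applying the factors to v, the last nonzero vector is an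
eigenvector; P collects the properties that the factors preserve, which is how
common eigenvectors of commuting operators are obtained below. *)
Lemma ex_eigenvector (P : 'M[K]_(m, n) -> Prop) A ks v :
    (forall k w, P w -> P (w *m A - k *: w)) ->
    P v -> v != 0 -> shift_prod A ks v = 0 ->
  exists w k, [/\ P w, w != 0, k \in ks & w *m A = k *: w].
Proof.
move=> PA; elim: ks v => [|k ks IHks] v Pv v0 /=.
  by move=> vE; rewrite vE eqxx in v0.
have [/subr0_eq vA _|vk] := eqVneq (v *m A - k *: v) 0.
  by exists v, k; rewrite mem_head.
move=> /(IHks _ (PA k v Pv) vk)[w [l [Pw w0 lks wA]]].
by exists w, l; rewrite in_cons lks orbT.
Qed.

Lemma eigenvalue_shift_prod A ks v a :
  v != 0 -> v *m A = a *: v -> shift_prod A ks v = 0 -> a \in ks.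
Proof.
move=> v0 vA; move/(@ex_eigenvector (fun w => w *m A = a *: w)).
case=> // [k w wA|w [k [wA w0 kks]]].
  by rewrite wA -scalerBl -scalemxAl wA scalerA mulrC -scalerA.
move: wA => -> /eqP; rewrite -subr_eq0 -scalerBl scaler_eq0 (negPf w0) orbF.
by rewrite subr_eq0 => /eqP ->.
Qed.

End Eigenvectors.

(** * Elementary, reflection and torus elements of GL_3 *)

Section Elements.
Variable F : finFieldType.
Implicit Types (i j k a b : 'I_3) (s t : F) (r : 'I_3 -> F).

(** Turns a matrix known to be invertible into a group element; the default 1 is
only reached on singular matrices. *)
Definition GL_of (A : 'M[F]_3) : {'GL_3[F]} := insubd (1%g : {'GL_3[F]}) A.

Lemma GL_ofE A : A \in unitmx -> GLval (GL_of A) = A.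
Proof. exact: (insubdK (1%g : {'GL_3[F]})). Qed.

Lemma GLval_inj : injective (@GLval 3 F).
Proof. exact: val_inj. Qed.

Definition elem i j s := GL_of (1%:M + s *: delta_mx i j).
Arguments elem i j s%_R.
Definition refl i j := GL_of (tperm_mx i j).
Definition torus r := GL_of (diag_mx (\row_k r k)).

(** The torus part of the Bruhat decomposition of elem j i s, for nonzero s: this
is diag(-1/s, s) in the rows i and j, rather than diag(1/s, s), because the Weyl
group is represented by permutation matrices, which have determinant -1. *)
Definition coroot i j s :=
  torus (fun k => if k == i then - s^-1 else if k == j then s else 1).
Arguments coroot i j s%_R.

Lemma elemE i j s : i != j -> GLval (elem i j s) = 1%:M + s *: delta_mx i j.
Proof.
move=> nij; apply: GL_ofE.
suff /mulmx1_unit[]: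
  (1%:M + s *: delta_mx i j) *m (1%:M - s *: delta_mx i j) = 1%:M :> 'M[F]_3 by [].
rewrite mulmxDl mul1mx mulmxBr mulmx1 -scalemxAr -scalemxAl.
by rewrite mul_delta_mx_0 1?[j == _]eq_sym // !scaler0 subr0 subrK.
Qed.

Lemma reflE i j : GLval (refl i j) = tperm_mx i j.
Proof. by rewrite GL_ofE // unitmx_perm. Qed.

Lemma torusE r : (forall k, r k != 0) -> GLval (torus r) = diag_mx (\row_k r k).
Proof.
move=> r0; rewrite GL_ofE // unitmxE det_diag unitfE.
by apply/prodf_neq0 => k _; rewrite mxE.
Qed.

Lemma coroot_neq0 i j s : s != 0 ->
  forall k, (if k == i then - s^-1 else if k == j then s else 1) != 0.
Proof.
by move=> s0 k; case: ifP => _; last case: ifP => _;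
  rewrite ?oppr_eq0 ?invr_eq0 ?oner_neq0.
Qed.

Lemma elemD i j s t : i != j -> (elem i j s * elem i j t)%g = elem i j (s + t).
Proof.
move=> nij; apply: GLval_inj; rewrite GL_MxE !elemE //.
rewrite mulmxDl mul1mx mulmxDr mulmx1 -scalemxAr -scalemxAl.
rewrite mul_delta_mx_0 1?[j == _]eq_sym // !scaler0 addr0 scalerDl.
by rewrite [s *: _ + _]addrC addrA.
Qed.

Lemma elemC i j k l s t : i != j -> k != l -> j != k -> i != l ->
  (elem i j s * elem k l t = elem k l t * elem i j s)%g.
Proof.
move=> nij nkl njk nil; apply: GLval_inj; rewrite !GL_MxE !elemE //.
rewrite !mulmxDl !mulmxDr !mulmx1 !mul1mx -!scalemxAl -!scalemxAr.
by rewrite !mul_delta_mx_0 1?[l == _]eq_sym // !scaler0 !addr0 addrAC.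
Qed.

Lemma elem_comm i j k s t : i != j -> j != k -> i != k ->
  (elem i j s * elem j k t = elem j k t * elem i k (s * t) * elem i j s)%g.
Proof.
move=> nij njk nik; apply: GLval_inj; rewrite !GL_MxE !elemE //.
rewrite !(mulmxDl, mulmxDr, mulmx1, mul1mx) -!(scalemxAl, scalemxAr).
rewrite !mul_delta_mx !mul_delta_mx_0 1?[k == _]eq_sym 1?[j == i]eq_sym //.
rewrite ?scaler0 ?mul0mx ?addr0 scalerA.
by rewrite ?scaler0 add0r ?addr0; apply/matrixP=> a b; rewrite !mxE; ring.
Qed.

Lemma refl2 i j : (refl i j * refl i j)%g = 1%g.
Proof.
apply: GLval_inj; rewrite GL_MxE GL_1E reflE /tperm_mx -perm_mxM tperm2.
by rewrite perm_mx1.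
Qed.

Lemma mul_tperm_mx (A : 'M[F]_3) i j a b :
  (A *m tperm_mx i j) a b = A a (tperm i j b).
Proof. by rewrite /tperm_mx -{1}tpermV -col_permE mxE. Qed.

Lemma tperm_mx_mul (A : 'M[F]_3) i j a b :
  (tperm_mx i j *m A) a b = A (tperm i j a) b.
Proof. by rewrite /tperm_mx -row_permE mxE. Qed.

Lemma tperm_eq i j a b : (a == tperm i j b) = (tperm i j a == b).
Proof. by rewrite (can2_eq (tpermK i j) (tpermK i j)). Qed.

Lemma elem_refl i j a b s : a != b ->
  (elem a b s * refl i j = refl i j * elem (tperm i j a) (tperm i j b) s)%g.
Proof.
move=> nab; apply: GLval_inj; rewrite !GL_MxE !elemE ?(inj_eq perm_inj) // reflE.
apply/matrixP=> k l; rewrite mul_tperm_mx tperm_mx_mul !mxE.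
by rewrite tperm_eq (inj_eq perm_inj) tperm_eq.
Qed.

Lemma torus_refl i j r : (forall k, r k != 0) ->
  (torus r * refl i j = refl i j * torus (r \o tperm i j))%g.
Proof.
move=> r0; apply: GLval_inj; rewrite !GL_MxE !torusE ?reflE //; last first.
  by move=> k; apply: r0.
apply/matrixP=> k l; rewrite mul_tperm_mx tperm_mx_mul !mxE tperm_eq /=.
by rewrite tpermK.
Qed.

Lemma torusM r r' : (forall k, r k != 0) -> (forall k, r' k != 0) ->
  (torus r * torus r')%g = torus (fun k => r k * r' k).
Proof.
move=> r0 r'0; apply: GLval_inj; rewrite GL_MxE !torusE //; last first.
  by move=> k; rewrite mulf_neq0.
by rewrite mulmx_diag; congr diag_mx; apply/rowP=> k; rewrite !mxE.
Qed.

Lemma eq_torus r r' : r =1 r' -> torus r = torus r'.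
Proof. by move=> rr'; congr (GL_of (diag_mx _)); apply/rowP=> k; rewrite !mxE. Qed.

Lemma elem_torus a b r t : (forall k, r k != 0) -> a != b ->
  (elem a b t * torus r = torus r * elem a b ((r a)^-1 * t * r b))%g.
Proof.
move=> r0 nab; apply: GLval_inj; rewrite !GL_MxE !elemE // torusE //.
apply/matrixP=> k l; rewrite mul_mx_diag mul_diag_mx !mxE.
case: (k =P a) => [->|_]; case: (l =P b) => [->|_] /=; rewrite ?mulr0 ?addr0.
- by rewrite (negPf nab) /= !mulr1 !add0r -!mulrA mulVKf.
- by case: eqP => [->|_]; rewrite /= ?mulr0n ?mulr1n; ring.
- by case: eqP => [->|_]; rewrite /= ?mulr0n ?mulr1n; ring.
by case: eqP => [->|_]; rewrite /= ?mulr0n ?mulr1n; ring.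
Qed.

Lemma coroot_refl i j s : i != j -> s != 0 ->
  (coroot i j s * refl i j = refl i j * coroot i j (- s^-1))%g.
Proof.
move=> nij s0; rewrite torus_refl; last exact: coroot_neq0.
congr (_ * _)%g; apply: eq_torus => k /=; rewrite invrN invrK opprK.
case: tpermP => [->|->|/eqP/negPf-> /eqP/negPf-> //];
  rewrite ?eqxx //; by rewrite eq_sym (negPf nij).
Qed.

(** Three factors and not two: the coroot elements form a coset of a subgroup, by
an element of order dividing 2. *)
Lemma coroot3 i j s t u : s != 0 -> t != 0 -> u != 0 ->
  (coroot i j s * coroot i j t * coroot i j u)%g = coroot i j (s * t * u).
Proof.
move=> s0 t0 u0; have d0 := coroot_neq0 i j.
rewrite [X in (X * _)%g]torusM ?torusM; try by move=> k; rewrite ?mulf_neq0 ?d0.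
apply: eq_torus => k.
by case: ifP => _; [rewrite !invfM; ring | case: ifP => _; rewrite ?mulr1].
Qed.

Lemma delta_mx_mul (A : 'M[F]_3) i j a b :
  (delta_mx i j *m A) a b = (a == i)%:R * A j b.
Proof.
rewrite mxE (bigD1 j) //= big1 => [|k /negPf nkj].
  by rewrite mxE eqxx andbT addr0.
by rewrite mxE nkj andbF mul0r.
Qed.

(** The Bruhat decomposition in the rank-one group of i and j: a nontrivial lower
elementary matrix lies in the big cell. This is the source of the quadratic
relation. *)
Lemma elem_bruhat i j s : i != j -> s != 0 ->
  elem j i s =
    (elem i j s^-1 * (coroot i j s * refl i j) * elem i j s^-1)%g.
Proof.
move=> nij s0; have nji: j != i by rewrite eq_sym.
suff mE: (elem j i s * elem i j (- s^-1) =
    elem i j s^-1 * (coroot i j s * refl i j))%g.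
  rewrite -mE -mulgA elemD // addNr; apply: GLval_inj.
  by rewrite GL_MxE [X in _ *m X]elemE // scale0r addr0 mulmx1.
apply: GLval_inj; rewrite !GL_MxE !elemE // reflE torusE; last exact: coroot_neq0.
apply/matrixP=> a b; rewrite !mulmxDl !mulmxDr !mul1mx !mulmx1.
rewrite -!scalemxAl -!scalemxAr mul_delta_mx.
rewrite [RHS]mxE [X in _ = _ + X]mxE delta_mx_mul !mul_tperm_mx !mxE.
rewrite !tperm_eq tpermR eqxx (negPf nji).
case: tpermP => [->|->|/eqP/negPf na /eqP/negPf nb].
- rewrite eqxx (negPf nij) ?(eq_sym _ b) /= ?mulr0 ?mulr1 ?addr0 ?add0r.
  rewrite ?mulr0n ?mulr1n.
  by case: (b == i); case: (b == j); rewrite /= ?mulr0n ?mulr1n ?mulr0 ?mulr1; field.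
- rewrite eqxx (negPf nji) ?(eq_sym _ b) /= ?mul0r ?mulr0 ?mulr1 ?addr0.
  rewrite ?add0r ?mulr0n ?mulr1n.
  by case: (b == i); case: (b == j); rewrite /= ?mulr0n ?mulr1n ?mulr0 ?mulr1; field.
by rewrite na nb /= ; ring.
Qed.

End Elements.
Arguments refl {F} i j.

(** * The quadratic relation of a rank-one Hecke generator *)

Section RankOne.
Variables (K : numFieldType) (F : finFieldType) (n : nat).
Variable rG : mx_representation K 'GL_3[F]%G n.
Implicit Types (i j k a b : 'I_3) (s t : F) (r : 'I_3 -> F).
Local Notation q := (#|F|%:R : K).

Lemma rGM g h : rG (g * h)%g = rG g *m rG h.
Proof. by rewrite repr_mxM ?inE. Qed.

Definition root_sum a b := \sum_s rG (elem a b s).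
Definition coroot_sum i j := \sum_(s | s != 0) rG (coroot i j s).

(** On vectors fixed by the i, j root subgroup this is the standard generator of
the Yokonuma-Hecke algebra: moving the reflection to the left, it sums over
coset representatives of the reflection double coset. *)
Definition hecke_gen i j := root_sum j i *m rG (refl i j).

Local Notation X := root_sum.
Local Notation E := coroot_sum.
Local Notation T := hecke_gen.

Lemma root_sum_refl i j a b : a != b ->
  X a b *m rG (refl i j) = rG (refl i j) *m X (tperm i j a) (tperm i j b).
Proof.
move=> nab; rewrite mulmx_suml mulmx_sumr; apply: eq_bigr => s _.
by rewrite -!rGM elem_refl.
Qed.

Lemma root_sum_torus a b r : a != b -> (forall k, r k != 0) ->
  X a b *m rG (torus r) = rG (torus r) *m X a b.
Proof.
move=> nab r0; rewrite mulmx_suml mulmx_sumr.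
have cancr : cancel (fun t => (r a)^-1 * t * r b) (fun t => r a * t / r b).
  by move=> t; have ra0 := r0 a; have rb0 := r0 b; field; rewrite ra0 rb0.
rewrite [RHS](reindex_inj (can_inj cancr)); apply: eq_bigr => s _.
by rewrite -!rGM elem_torus.
Qed.

Lemma elem_root_sum a b s : a != b -> rG (elem a b s) *m X a b = X a b.
Proof.
move=> nab; rewrite mulmx_sumr [RHS](reindex_inj (addrI s)); apply: eq_bigr => t _.
by rewrite -rGM elemD.
Qed.

Lemma root_sum_elem a b s : a != b -> X a b *m rG (elem a b s) = X a b.
Proof.
move=> nab; rewrite mulmx_suml [RHS](reindex_inj (addIr s)); apply: eq_bigr => t _.
by rewrite -rGM elemD.
Qed.

Lemma rG_refl2 i j : rG (refl i j) *m rG (refl i j) = 1%:M.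
Proof. by rewrite -rGM refl2 repr_mx1. Qed.

Lemma hecke_gen_sqr i j : i != j -> T i j *m T i j = X j i *m X i j.
Proof.
move=> nij; rewrite /T -mulmxA root_sum_refl 1?eq_sym // tpermL tpermR.
by rewrite (mulmxA (rG _)) rG_refl2 mul1mx.
Qed.

Lemma hecke_gen_coroot_sum i j : i != j -> T i j *m E i j = E i j *m T i j.
Proof.
move=> nij; rewrite mulmx_suml mulmx_sumr.
(* Conjugation by the reflection exchanges the entries -1/s and s. *)
have invK : involutive (fun s : F => - s^-1).
  by move=> s; rewrite invrN invrK opprK.
rewrite [LHS](reindex_inj (inv_inj invK)) /=.
apply: eq_big => s; first by rewrite oppr_eq0 invr_eq0.
rewrite oppr_eq0 invr_eq0 => s0; rewrite -mulmxA -rGM -coroot_refl // rGM.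
by rewrite !mulmxA root_sum_torus 1?eq_sym //; apply: coroot_neq0.
Qed.

(** Multiplication by two coroot elements permutes all coroot elements, so it fixes
their sum, and there are (q - 1)^2 such pairs. *)
Lemma coroot_sum3 i j :
  E i j *m E i j *m E i j = (q - 1) ^+ 2 *: E i j.
Proof.
have cardF : \sum_(s : F | s != 0) 1 = q - 1 :> K.
  by apply/eqP; rewrite eq_sym subr_eq -sumr_const (bigD1 (0 : F)) //= addrC.
rewrite expr2 -scalerA -cardF.
have EE s t : s != 0 -> t != 0 ->
    rG (coroot i j s) *m rG (coroot i j t) *m E i j = E i j.
  move=> s0 t0; have st0 := mulf_neq0 s0 t0.
  rewrite mulmx_sumr [RHS](reindex_inj (mulfI st0)) /=.
  apply: eq_big => u; first by rewrite mulf_eq0 (negPf st0).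
  by move=> u0; rewrite -!rGM coroot3.
rewrite -mulmxA {1}/E mulmx_suml scaler_suml; apply: eq_bigr => s s0.
rewrite scale1r scaler_suml {1}/E mulmx_suml mulmx_sumr; apply: eq_bigr => t t0.
by rewrite mulmxA EE // scale1r.
Qed.

Section Vectors.
Variable m : nat.
Implicit Types v w : 'M[K]_(m, n).

Definition fixed a b v := forall s, v *m rG (elem a b s) = v.

Lemma fixed_root_sum a b v : fixed a b v -> v *m X a b = q *: v.
Proof.
move=> fv; rewrite mulmx_sumr (eq_bigr (fun=> v)) => [|s _]; last exact: fv.
by rewrite sumr_const scaler_nat.
Qed.

Lemma fixed_torus a b r v : (forall k, r k != 0) -> a != b ->
  fixed a b v -> fixed a b (v *m rG (torus r)).
Proof.
move=> r0 nab fv s; have ra0 := r0 a; have rb0 := r0 b.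
rewrite -mulmxA -rGM -[s](_ : (r a)^-1 * (r a * s / r b) * r b = s).
  by rewrite -elem_torus // rGM mulmxA fv.
by field; rewrite ra0 rb0.
Qed.

Lemma fixed_coroot_sum a b i j v : a != b -> fixed a b v -> fixed a b (v *m E i j).
Proof.
move=> nab fv s; rewrite mulmx_sumr mulmx_suml; apply: eq_bigr => t t0.
by rewrite fixed_torus //; apply: coroot_neq0.
Qed.

Lemma fixed_refl a b i j v : a != b -> fixed (tperm i j a) (tperm i j b) v ->
  fixed a b (v *m rG (refl i j)).
Proof.
move=> nab fv s; rewrite -mulmxA -rGM.
rewrite -[a in elem a b](tpermK i j) -[b in elem _ b](tpermK i j).
by rewrite -elem_refl ?(inj_eq perm_inj) // rGM mulmxA fv.
Qed.

Lemma fixed_hecke_gen i j v : i != j -> fixed i j (v *m T i j).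
Proof.
move=> nij; rewrite mulmxA; apply: fixed_refl; rewrite // tpermL tpermR.
by move=> s; rewrite -mulmxA root_sum_elem // eq_sym.
Qed.

(** T_ij^2 is X_ji X_ij, since the two reflections cancel. In X_ji, the term of
the identity gives q v and, by the Bruhat decomposition, each of the others
contributes one coroot element followed by T_ij. *)
Lemma fixed_hecke_gen_quadratic i j v : i != j -> fixed i j v ->
  v *m T i j *m T i j = q *: v + v *m E i j *m T i j.
Proof.
move=> nij fv; rewrite -mulmxA hecke_gen_sqr // {1}/X mulmx_suml (bigD1 0) //=.
rewrite mulmxDr; congr (_ + _).
  rewrite -(fixed_root_sum fv); congr (_ *m _).
  have -> : elem j i 0 = 1%g :> {'GL_3[F]}.
    by apply: GLval_inj; rewrite elemE 1?eq_sym // scale0r addr0.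
  by rewrite repr_mx1 mul1mx.
rewrite -mulmxA mulmx_sumr mulmx_suml mulmx_sumr; apply: eq_bigr => s s0.
rewrite elem_bruhat // !rGM -!mulmxA elem_root_sum // !mulmxA fv.
by rewrite /T -!mulmxA root_sum_refl 1?eq_sym // tpermL tpermR.
Qed.

End Vectors.

End RankOne.

(** * The cubic relation and the stability of fixed vectors *)

Section FixedVectors.
Variables (K : numFieldType) (F : finFieldType) (n : nat).
Variable rG : mx_representation K 'GL_3[F]%G n.
Implicit Types (i j k a b : 'I_3) (s t : F) (r : 'I_3 -> F).
Local Notation q := (#|F|%:R : K).
Local Notation X := (root_sum rG).
Local Notation E := (coroot_sum rG).
Local Notation T := (hecke_gen rG).
Local Notation rGM := (rGM rG).

Section Fixed.
Variable m : nat.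
Implicit Types v w : 'M[K]_(m, n).

(** With T^2 - q = E T, the remaining factors give
(T^2 - 1)(T^2 - q^2) = (E T)^2 - (q - 1)^2 T^2 = (E^2 - (q - 1)^2) T^2,
and the product vanishes because E^3 = (q - 1)^2 E. *)
Lemma hecke_gen_sqr_roots i j v : i != j -> fixed rG i j v ->
  shift_prod (T i j *m T i j) [:: q; 1; q ^+ 2] v = 0.
Proof.
move=> nij fv; rewrite /shift_prod /= scale1r ![_ *m (T i j *m T i j)]mulmxA.
have -> : v *m T i j *m T i j - q *: v = v *m E i j *m T i j.
  by rewrite fixed_hecke_gen_quadratic // addrC addKr.
have TE := hecke_gen_coroot_sum rG nij; have E3 := coroot_sum3 rG i j.
set w := v *m E i j *m T i j; set z := w *m T i j *m T i j.
have fw : fixed rG i j w by apply: fixed_hecke_gen.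
have zE : z = q *: w + w *m E i j *m T i j by apply: fixed_hecke_gen_quadratic.
have wEE : w *m E i j *m E i j = (q - 1) ^+ 2 *: w.
  have vE3 : v *m E i j *m E i j *m E i j = (q - 1) ^+ 2 *: (v *m E i j).
    by rewrite -!(mulmxA v) E3 scalemxAr.
  rewrite /w -(mulmxA _ (T i j) (E i j)) TE mulmxA.
  rewrite -(mulmxA _ (T i j) (E i j)) TE mulmxA.
  by rewrite vE3 -scalemxAl.
have zET : z *m E i j *m T i j = q *: (w *m E i j *m T i j) + (q - 1) ^+ 2 *: z.
  have -> : z *m E i j = w *m E i j *m T i j *m T i j.
    rewrite /z -(mulmxA _ (T i j) (E i j)) TE mulmxA.
    by rewrite -(mulmxA w (T i j) (E i j)) TE (mulmxA w (E i j) (T i j)).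
  rewrite (fixed_hecke_gen_quadratic nij (fixed_coroot_sum i j nij fw)).
  by rewrite mulmxDl -scalemxAl wEE -!scalemxAl.
have zTT : z *m T i j *m T i j = q *: z + z *m E i j *m T i j.
  by apply: fixed_hecke_gen_quadratic; rewrite // /z; apply: fixed_hecke_gen.
have wET : w *m E i j *m T i j = z - q *: w by rewrite zE addrC addKr.
rewrite !mulmxBl -/z zTT zET wET; move: (z) (w) => x y.
by apply/matrixP=> a b; rewrite !mxE; ring.
Qed.

Lemma coroot_sum_roots i j v : shift_prod (E i j) [:: 0; q - 1; 1 - q] v = 0.
Proof.
rewrite /shift_prod /= scale0r subr0 !mulmxBl -scalemxAl -!mulmxA.
rewrite (mulmxA (E i j)) coroot_sum3.
rewrite -scalemxAr; move: (v *m E i j) (v *m (E i j *m E i j)) => x y.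
by apply/matrixP=> a b; rewrite !mxE; ring.
Qed.

Lemma fixed_root_sumC a b i j v : a != b -> i != j -> b != i -> a != j ->
  fixed rG a b v -> fixed rG a b (v *m X i j).
Proof.
move=> nab nij nbi naj fv s; rewrite mulmx_sumr mulmx_suml; apply: eq_bigr => t _.
by rewrite -mulmxA -rGM -elemC // rGM mulmxA fv.
Qed.

(** Here and in the next lemma the two root subgroups do not commute; the
commutators lie in the i, k root subgroup, which also fixes v. *)
Lemma fixed_root_suml i j k v : i != j -> j != k -> i != k ->
  fixed rG j k v -> fixed rG i k v -> fixed rG j k (v *m X i j).
Proof.
move=> nij njk nik fjk fik s; rewrite mulmx_sumr mulmx_suml; apply: eq_bigr => t _.
by rewrite -mulmxA -rGM elem_comm // !rGM !mulmxA fjk fik.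
Qed.

Lemma fixed_root_sumr i j k v : i != j -> j != k -> i != k ->
  fixed rG i j v -> fixed rG i k v -> fixed rG i j (v *m X j k).
Proof.
move=> nij njk nik fij fik s; rewrite mulmx_sumr mulmx_suml; apply: eq_bigr => t _.
rewrite -[in RHS](fij s) -(mulmxA _ (rG (elem i j s))) -rGM elem_comm //.
have nki : k != i by rewrite eq_sym.
by rewrite (elemC _ _ njk nik) // !rGM !mulmxA fik.
Qed.

End Fixed.

End FixedVectors.

(** * Spectrum of the Jucys-Murphy element *)

Section Spectrum.
Variables (K : numFieldType) (F : finFieldType) (n : nat).
Variable rG : mx_representation K 'GL_3[F]%G n.
Implicit Types (i j k a b : 'I_3) (s t : F) (r : 'I_3 -> F).
Local Notation q := (#|F|%:R : K).
Local Notation X := (root_sum rG).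
Local Notation E := (coroot_sum rG).
Local Notation T := (hecke_gen rG).
Local Notation rGM := (rGM rG).
Local Notation S1 := (T 0 1).
Local Notation S2 := (T 1 2%:R).

(** The Jucys-Murphy element of the Hecke algebra of type A_2, built from the
square of the generator S1. *)
Definition murphy := S2 *m (S1 *m S1) *m S2.

Lemma root_sumC i j k l : i != j -> k != l -> j != k -> i != l ->
  X i j *m X k l = X k l *m X i j.
Proof.
move=> nij nkl njk nil; rewrite mulmx_suml mulmx_sumr; apply: eq_bigr => s _.
rewrite mulmx_suml mulmx_sumr; apply: eq_bigr => t _.
by rewrite -!rGM elemC.
Qed.

(** Moving the reflection of S2 through the root sums leaves the sums of the two
opposite abelian unipotent groups, so that an element that is visibly normalised
by the Levi subgroup appears. *)
Lemma murphyE : murphy = X 2%:R 1 *m X 2%:R 0 *m (X 0 2%:R *m X 1 2%:R).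
Proof.
have W2 := rG_refl2 rG 1 2%:R; set W := rG (refl 1 2%:R) in W2.
have h1 : X 2%:R 1 *m W = W *m X 1 2%:R by rewrite root_sum_refl // tpermL tpermR.
have h2 : W *m X 1 0 = X 2%:R 0 *m W by rewrite root_sum_refl // tpermR tpermD.
have h3 : X 0 1 *m W = W *m X 0 2%:R by rewrite root_sum_refl // tpermL tpermD.
rewrite /murphy hecke_gen_sqr // /hecke_gen -/W {2}h1 !mulmxA -(mulmxA _ W (X 1 0)) h2.
by rewrite mulmxA -(mulmxA _ (X 0 1) W) h3 mulmxA -(mulmxA _ W W) W2 mulmx1.
Qed.

Lemma root_sum_elemC i j k l s : i != j -> k != l -> j != k -> i != l ->
  X i j *m rG (elem k l s) = rG (elem k l s) *m X i j.
Proof.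
move=> nij nkl njk nil; rewrite mulmx_suml mulmx_sumr; apply: eq_bigr => t _.
by rewrite -!rGM elemC.
Qed.

(** An elementary matrix normalises the abelian group of a row (and, below, of a
column), hence commutes with the sum of that group. *)
Lemma row_sums_elem i j k s : i != j -> j != k -> i != k ->
  X i j *m X i k *m rG (elem j k s) = rG (elem j k s) *m (X i j *m X i k).
Proof.
move=> nij njk nik; have nki : k != i by rewrite eq_sym.
have nji : j != i by rewrite eq_sym.
have nkj : k != j by rewrite eq_sym.
rewrite -mulmxA root_sum_elemC // mulmxA [X i j *m X i k]root_sumC //.
rewrite {1}/(X i j) 2!mulmx_suml /(X i j) 2!mulmx_sumr; apply: eq_bigr => t _.
rewrite -rGM elem_comm // !rGM -!mulmxA; congr (_ *m _).
by rewrite -root_sum_elemC // mulmxA elem_root_sum.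
Qed.

Lemma col_sums_elem i j k s : i != j -> j != k -> i != k ->
  X j k *m X i k *m rG (elem i j s) = rG (elem i j s) *m (X j k *m X i k).
Proof.
move=> nij njk nik; have nki : k != i by rewrite eq_sym.
have nkj : k != j by rewrite eq_sym.
have nji : j != i by rewrite eq_sym.
rewrite /(X j k) 2!mulmx_suml mulmx_sumr; apply: eq_bigr => t _.
rewrite [RHS]mulmxA -rGM elem_comm // !rGM -!mulmxA; congr (_ *m _).
by rewrite -root_sum_elemC // [in RHS]mulmxA elem_root_sum.
Qed.

Lemma root_pair_comm g A B A' B' :
  A *m rG g = rG g *m A' -> B *m rG g = rG g *m B' -> A' *m B' = A *m B ->
  A *m B *m rG g = rG g *m (A *m B).
Proof. by move=> Ag Bg AB; rewrite -mulmxA Bg mulmxA Ag -mulmxA AB. Qed.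

Lemma murphy_refl01 : murphy *m rG (refl 0 1) = rG (refl 0 1) *m murphy.
Proof.
rewrite murphyE; apply: root_pair_comm (erefl _).
  apply: (root_pair_comm (A' := X 2%:R 0) (B' := X 2%:R 1)); last exact: root_sumC.
    by rewrite root_sum_refl // tpermR tpermD.
  by rewrite root_sum_refl // tpermL tpermD.
apply: (root_pair_comm (A' := X 1 2%:R) (B' := X 0 2%:R)); last exact: root_sumC.
  by rewrite root_sum_refl // tpermL tpermD.
by rewrite root_sum_refl // tpermR tpermD.
Qed.

Lemma murphy_torus r : (forall k, r k != 0) ->
  murphy *m rG (torus r) = rG (torus r) *m murphy.
Proof.
by move=> r0; rewrite murphyE; do 2!apply: root_pair_comm => //; apply: root_sum_torus.
Qed.

Lemma murphy_elem10 s : murphy *m rG (elem 1 0 s) = rG (elem 1 0 s) *m murphy.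
Proof.
rewrite murphyE; apply: root_pair_comm (erefl _).
  exact: row_sums_elem.
exact: col_sums_elem.
Qed.

Lemma murphy_gen1 : murphy *m S1 = S1 *m murphy.
Proof.
rewrite /(T 0 1) [LHS]mulmxA -[RHS]mulmxA -murphy_refl01 [RHS]mulmxA; congr (_ *m _).
rewrite mulmx_sumr mulmx_suml; apply: eq_bigr => s _; exact: murphy_elem10.
Qed.

Lemma comm_coroot_sum A i j :
    (forall r, (forall k, r k != 0) -> A *m rG (torus r) = rG (torus r) *m A) ->
  A *m E i j = E i j *m A.
Proof.
move=> Ar; rewrite /(E i j) mulmx_sumr mulmx_suml; apply: eq_bigr => s s0.
by apply: Ar; apply: coroot_neq0.
Qed.

Lemma murphy_coroot_sum i j : murphy *m E i j = E i j *m murphy.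
Proof. exact/comm_coroot_sum/murphy_torus. Qed.

Lemma gen1_sqr_coroot_sum i j : S1 *m S1 *m E i j = E i j *m (S1 *m S1).
Proof.
rewrite hecke_gen_sqr //; apply: comm_coroot_sum => r r0.
by apply: root_pair_comm (erefl _); apply: root_sum_torus.
Qed.

Section Vectors.
Variable m : nat.
Implicit Types v w : 'M[K]_(m, n).

Definition unip_fixed v :=
  [/\ fixed rG 0 1 v, fixed rG 0 2%:R v & fixed rG 1 2%:R v].

Lemma unip_fixed_gen1 v : unip_fixed v -> unip_fixed (v *m S1).
Proof.
move=> [f01 f02 f12]; split; first exact: fixed_hecke_gen.
  rewrite /(T 0 1) mulmxA; apply: fixed_refl; rewrite // tpermL tpermD //.
  exact: fixed_root_sumC.
rewrite /(T 0 1) mulmxA; apply: fixed_refl; rewrite // tpermR tpermD //.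
exact: fixed_root_suml.
Qed.

Lemma unip_fixed_gen2 v : unip_fixed v -> unip_fixed (v *m S2).
Proof.
move=> [f01 f02 f12]; split; last exact: fixed_hecke_gen.
  rewrite /(T 1 2%:R) mulmxA; apply: fixed_refl; rewrite // tpermL tpermD //.
  exact: fixed_root_sumr.
rewrite /(T 1 2%:R) mulmxA; apply: fixed_refl; rewrite // tpermR tpermD //.
exact: fixed_root_sumC.
Qed.

Lemma unip_fixed_coroot_sum i j v : unip_fixed v -> unip_fixed (v *m E i j).
Proof. by case=> *; split; apply: fixed_coroot_sum. Qed.

Lemma unip_fixedB (c : K) v w : unip_fixed v -> unip_fixed w -> unip_fixed (v - c *: w).
Proof.
case=> v1 v2 v3 [w1 w2 w3]; split=> s; rewrite mulmxBl -scalemxAl.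
- by rewrite v1 w1.
- by rewrite v2 w2.
by rewrite v3 w3.
Qed.

(** The rank-two argument: the quadratic relation makes L triangular on the span
of w and w S2, and L has only three possible eigenvalues. *)
Theorem murphy_spectrum (a : K) v : unip_fixed v -> v != 0 -> v *m murphy = a *: v ->
  a \in [:: 1; q; q ^+ 2; q ^+ 3; q ^+ 4].
Proof.
move=> fv v0 va; set L := S1 *m S1.
have q0 : q != 0 by rewrite pnatr_eq0 -lt0n; apply/card_gt0P; exists 0.
have fL w : unip_fixed w -> unip_fixed (w *m L).
  by move=> fw; rewrite mulmxA; do 2!apply: unip_fixed_gen1.
have RL : L *m murphy = murphy *m L.
  by rewrite /L -mulmxA -murphy_gen1 mulmxA -murphy_gen1 -mulmxA.
have eigC (A B : 'M[K]_n) (b c : K) w : A *m B = B *m A ->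
    w *m B = b *: w -> (w *m A - c *: w) *m B = b *: (w *m A - c *: w).
  move=> AB wB; rewrite mulmxBl -mulmxA AB mulmxA wB -!scalemxAl wB scalerBr.
  by rewrite !scalerA (mulrC b).
have killL w : unip_fixed w -> shift_prod L [:: q; 1; q ^+ 2] w = 0.
  by case=> *; apply: hecke_gen_sqr_roots.
pose P1 w := unip_fixed w /\ w *m murphy = a *: w.
have P1L c w : P1 w -> P1 (w *m L - c *: w).
  move=> [fw wa]; split; last exact: eigC.
  by apply: unip_fixedB => //; apply: fL.
have [w1 [l [P1w1 w10 lq w1L]]] := ex_eigenvector P1L (conj fv va) v0 (killL v fv).
pose P2 w := P1 w /\ w *m L = l *: w.
have P2E c w : P2 w -> P2 (w *m E 1 2%:R - c *: w).
  move=> [[fw wa] wL]; split; last by apply: eigC; rewrite // gen1_sqr_coroot_sum.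
  split; last by apply: eigC; rewrite // murphy_coroot_sum.
  by apply: unip_fixedB => //; apply: unip_fixed_coroot_sum.
have [w [c [[[fw wa] wL] w0 cq wE]]] :=
  ex_eigenvector P2E (conj P1w1 w1L) w10 (coroot_sum_roots rG 1 2%:R w1).
set u := w *m S2.
have fu : unip_fixed u by apply: unip_fixed_gen2.
have TE : S2 *m E 1 2%:R = E 1 2%:R *m S2 by apply: hecke_gen_coroot_sum.
have quad (x : 'M_(m, n)) : unip_fixed x -> x *m E 1 2%:R = c *: x ->
    x *m S2 *m S2 = q *: x + c *: (x *m S2).
  by move=> [_ _ f12] xE; rewrite fixed_hecke_gen_quadratic // xE -scalemxAl.
have uT : u *m S2 = q *: w + c *: u by apply: quad.
have uE : u *m E 1 2%:R = c *: u.
  by rewrite /u -(mulmxA w S2) TE (mulmxA w _ S2) wE -scalemxAl.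
have uLT : u *m L *m S2 = a *: w.
  by rewrite -wa /murphy -/L (mulmxA w _ S2) (mulmxA w S2 L).
(* S2 (S2 - c) = q on unipotent-fixed vectors x with x E_12 = c x, such as u L:
   apply S2 - c to uLT. *)
have uL : q *: (u *m L) = a *: (u - c *: w).
  have := quad (u *m L) (fL u fu).
  rewrite -(mulmxA u L) gen1_sqr_coroot_sum (mulmxA u _ L) uE -scalemxAl => /(_ erefl).
  rewrite uLT -scalemxAl -/u => /eqP; rewrite -subr_eq => /eqP <-.
  by rewrite scalerBr !scalerA (mulrC a).
have uLq : u *m L = (a / q) *: (u - c *: w).
  by rewrite mulrC -scalerA -uL scalerA mulVf // scale1r.
have aqP : a / q \in [:: q; 1; q ^+ 2] -> a \in [:: 1; q; q ^+ 2; q ^+ 3; q ^+ 4].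
  have {2}-> : a = a / q * q by rewrite divfK.
  rewrite !inE => /or3P[] /eqP ->.
  - by rewrite -expr2 eqxx ?orbT.
  - by rewrite mul1r eqxx ?orbT.
  by rewrite -exprSr eqxx ?orbT.
have [al|al] := eqVneq (a / q) l; first by apply: aqP; rewrite al.
have al0 : a / q - l != 0 by rewrite subr_eq0.
(* k makes u - k w an eigenvector of L, unless it is zero. *)
pose k := c * (a / q) / (a / q - l).
have xL : (u - k *: w) *m L = (a / q) *: (u - k *: w).
  have kE : k * (a / q - l) = c * (a / q) by rewrite /k divfK.
  rewrite mulmxBl -scalemxAl wL uLq !scalerBr !scalerA -addrA -opprD -scalerDl.
  by rewrite (mulrC _ c) -kE; congr (_ - _ *: _); ring.
have [uk|x0] := eqVneq (u - k *: w) 0; last first.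
  by apply: aqP; apply: (eigenvalue_shift_prod x0 xL (killL _ _)); apply: unip_fixedB.
move/subr0_eq: uk => uk.
have scal_inj (x y : K) : x *: w = y *: w -> x = y.
  by move/eqP; rewrite -subr_eq0 -scalerBl scaler_eq0 (negPf w0) orbF subr_eq0 => /eqP.
have k2 : k * k = q + c * k.
  apply: scal_inj; have := uT.
  by rewrite uk -scalemxAl -/u uk !scalerA -scalerDl.
have ak : a = k * k * l.
  apply: scal_inj; rewrite -uLT uk -scalemxAl wL scalerA -scalemxAl -/u uk scalerA.
  by congr (_ *: _); ring.
have kq : k * k \in [:: q; 1; q ^+ 2].
  move: cq; rewrite !inE => /or3P[] /eqP cE.
  - by rewrite k2 cE mul0r addr0 eqxx.
  - have /eqP : (k - q) * (k + 1) = 0 by ring: k2 cE.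
    rewrite mulf_eq0 subr_eq0 addr_eq0 => /orP[] /eqP ->.
      by rewrite -expr2 eqxx ?orbT.
    by rewrite mulrNN mulr1 eqxx ?orbT.
  have /eqP : (k + q) * (k - 1) = 0 by ring: k2 cE.
  rewrite mulf_eq0 subr_eq0 addr_eq0 => /orP[] /eqP ->.
    by rewrite mulrNN -expr2 eqxx ?orbT.
  by rewrite mulr1 eqxx ?orbT.
rewrite ak; move: kq lq; rewrite !inE => /or3P[] /eqP -> /or3P[] /eqP ->.
all: by rewrite ?mulr1 ?mul1r -?exprSr -?exprS -?exprD -?expr2 eqxx ?orbT.
Qed.

End Vectors.

End Spectrum.

(** * The Radon transform as a Jucys-Murphy element *)

Section RadonMurphy.
Variables (K : numFieldType) (F : finFieldType).
Local Notation G := 'GL_3[F]%G.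
Local Notation rho := (regular_repr K G).
Local Notation X := (root_sum rho).
Local Notation q := (#|F|%:R : K).
Local Notation B := (U_mu F 3 [:: 1; 1; 1]%N).
Local Notation U := (U_mu F 3 [:: 2; 1]%N).
Local Notation V := (Uop_mu F 3 [:: 2; 1]%N).

Definition root_pair i j k l (p : F * F) := (elem i j p.1 * elem k l p.2)%g.

Lemma root_pairE i j k l p a b : i != j -> k != l -> j != k ->
  GLval (root_pair i j k l p) a b =
  (a == b)%:R + p.1 *+ ((a == i) && (b == j)) + p.2 *+ ((a == k) && (b == l)).
Proof.
move=> nij nkl njk; rewrite GL_MxE !elemE // mulmxDl mul1mx mulmxDr mulmx1.
rewrite -scalemxAl -scalemxAr mul_delta_mx_0 // !scaler0 addr0 !mxE.
by rewrite !mulr_natr addrAC.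
Qed.

Lemma root_pair_inj i j k l : i != j -> k != l -> j != k -> (i, j) != (k, l) ->
  injective (@root_pair i j k l).
Proof.
move=> nij nkl njk; rewrite xpair_eqE => nikjl [s t] [s' t'] eq_p.
have eq_ab a b : GLval (root_pair i j k l (s, t)) a b =
    GLval (root_pair i j k l (s', t')) a b.
  by rewrite eq_p.
have nkilj : ~~ ((k == i) && (l == j)) by rewrite (eq_sym k) (eq_sym l).
move: (eq_ab i j) (eq_ab k l); rewrite !root_pairE // !eqxx.
rewrite (negPf nij) (negPf nkl) (negPf nikjl) (negPf nkilj) /=.
by rewrite ?mulr0n ?mulr1n ?addr0 ?add0r => -> ->.
Qed.

Lemma gset_root_pair (H : {set {'GL_3[F]}}) i j k l :
    i != j -> k != l -> j != k -> (i, j) != (k, l) ->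
    (forall g, reflect (exists p, g = root_pair i j k l p) (g \in H)) ->
  gset_mx K G H = X i j *m X k l /\ #|H| = (#|F| * #|F|)%N.
Proof.
move=> nij nkl njk nikjl HP; have inj := root_pair_inj nij nkl njk nikjl.
have HE : H = [set root_pair i j k l p | p in setT].
  apply/setP=> g; apply/HP/imsetP=> [[p ->]|[p _ ->]]; by exists p.
split; last by rewrite HE card_imset // cardsT card_prod.
rewrite /gset_mx HE big_imset /=; last by move=> ? ? _ _; apply: inj.
rewrite mulmx_suml [RHS](eq_bigr (fun s => \sum_t rho (root_pair i j k l (s, t)))).
  by rewrite pair_big; apply: eq_big => [[s t]|[s t] _]; rewrite ?inE.
by move=> s _; rewrite mulmx_sumr; apply: eq_bigr => t _; rewrite -rGM.
Qed.

Lemma U21P g : reflect (exists p, g = root_pair 0 2%:R 1 2%:R p) (g \in U).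
Proof.
rewrite inE; apply: (iffP (block21P _)) => [[g00 g11 g22 [g10 g20 g21 g01]]|[p ->]].
  exists (GLval g 0 2%:R, GLval g 1 2%:R); apply: GLval_inj; apply/matrixP.
  do 2![apply: ord3P]; rewrite root_pairE //= ?(g00, g11, g22, g10, g20, g21, g01);
    by ring.
by split; last split; rewrite root_pairE //= !addr0.
Qed.

Lemma Uop21P g : reflect (exists p, g = root_pair 2%:R 1 2%:R 0 p) (g \in V).
Proof.
rewrite inE; apply: (iffP (block21P _)); rewrite !mxE.
  move=> [g00 g11 g22 [g10 g20 g21 g01]].
  exists (GLval g 2%:R 1, GLval g 2%:R 0); apply: GLval_inj; apply/matrixP.
  do 2![apply: ord3P]; rewrite root_pairE //= ?(g00, g11, g22, g10, g20, g21, g01);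
    by ring.
by move=> [p ->]; split; last split; rewrite root_pairE //= !addr0.
Qed.

(** A vector fixed by U absorbs the first idempotent, and the scalars cancel
because both abelian groups have order q^2. *)
Lemma unip_fixed_radon m (v : 'M[K]_(m, #|G|)) :
  unip_fixed rho v -> v *m radon K F = v *m murphy rho.
Proof.
move=> [_ f02 f12]; have q0 : q != 0.
  by rewrite pnatr_eq0 -lt0n; apply/card_gt0P; exists 0.
have [UE cU] : gset_mx K G U = X 0 2%:R *m X 1 2%:R /\ #|U| = (#|F| * #|F|)%N.
  by apply: gset_root_pair => //; apply: U21P.
have [VE cV] : gset_mx K G V = X 2%:R 1 *m X 2%:R 0 /\ #|V| = (#|F| * #|F|)%N.
  by apply: gset_root_pair => //; apply: Uop21P.
have vU : v *m subgroup_idem K G U = v.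
  rewrite /subgroup_idem cU UE natrM -scalemxAr mulmxA (fixed_root_sum f02).
  rewrite -scalemxAl (fixed_root_sum f12) !scalerA.
  by rewrite [X in X *: _](_ : _ = 1) ?scale1r //; field.
rewrite murphyE /radon -scalemxAr !mulmxA vU /subgroup_idem cU cV UE VE natrM.
rewrite -!scalemxAr -!scalemxAl scalerA !mulmxA.
by rewrite scalerA [X in X *: _](_ : _ = 1) ?scale1r //; field.
Qed.

Lemma hecke_unip_fixed x : x \in yokonuma_hecke K F -> unip_fixed rho x.
Proof.
case/hecke_algP => y _ ->; set e := subgroup_idem K G B.
have xB b : b \in B -> e *m rho b = e.
  by move=> Bb; apply: (subgroup_idemMr K (H := B_group F)); rewrite ?subGL.
by split=> s; rewrite -(mulmxA _ e) xB // inE; apply/block111P;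
  rewrite elemE // !mxE /= !mulr0 !addr0.
Qed.

End RadonMurphy.

Theorem theorem6p8 (R : realType) (F : finFieldType) (a : R[i]) :
  let q : R[i] := #|F|%:R in
  passmx.leigenvalue (radon_op R[i] F) a ->
  a \in [:: 1; q; q ^+ 2; q ^+ 3; q ^+ 4].
Proof.
move=> q; rewrite /passmx.leigenvalue -vpick0.
set x := vpick _ => x0.
have : x \in passmx.leigenspace (radon_op R[i] F) a by apply: memv_pick.
rewrite memv_ker add_lfunE opp_lfunE scale_lfunE id_lfunE subr_eq0 => /eqP xR.
have fx := hecke_unip_fixed (subvsP x).
apply: (@murphy_spectrum _ F _ (regular_repr R[i] 'GL_3[F]%G) _ a (vsval x)) => //.
by rewrite -unip_fixed_radon // -radon_opE xR linearZ.
Qed.
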